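(* Let $R$ be an integral domain, and let $S$ be a multiplicative subset of $R$ such that the extension $R \subseteq R_S$ is inert, where $R_S$ is the localization of $R$ at $S$. If $R$ is weak-ACCP, then $R_S$ is weak-ACCP.
   Context: Multiplicative subsets do not contain $0$, so that $R\subseteq R_S$. A ring extension $A \subseteq B$ of integral domains is inert if whenever $xy \in A$ for some $x,y \in B\setminus\{0\}$, there exists a unit $u \in B^\times$ such that $ux \in A$ and $u^{-1}y \in A$. An integral domain $R$ is atomic if every nonzero nonunit of $R$ is a finite product of irreducibles. An element $x\in R$ satisfies ACCP (in $R$) if every ascending chain of principal ideals of $R$ starting at $Rx$ eventually stabilizes. An integral domain $R$ is weak-ACCP if it is atomic and every nonempty finite subset $W$ of $R\setminus\{0\}$ has a common divisor $d\in R$ such that $\frac{w}{d}$ satisfies ACCP in $R$ for some $w\in W$. *)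

(* Defs.v *)
From HB Require Import structures.
From mathcomp Require Import all_boot all_order all_algebra.
From mathcomp Require Import boolp classical_sets cardinality.

Set Implicit Arguments.
Unset Strict Implicit.
Unset Printing Implicit Defensive.

Import GRing.Theory.
Local Open Scope classical_set_scope.
Local Open Scope ring_scope.

Record multSubset (R : idomainType) := MultSubset {
  mult_set :> set R;
  mult_set1 : mult_set 1;
  mult_setM : forall x y, mult_set x -> mult_set y -> mult_set (x * y);
  mult_set_neq0 : ~ mult_set 0 }.

(* The localization R_S, realized as the subring of the fraction field of R
   consisting of the fractions a / s with s in S. *)
Section Localization.
Variables (R : idomainType) (S : multSubset R).

Notation "x %:F" := (@FracField.tofrac R x).

Definition loc_pred : {pred {fraction R}} :=
  fun x => `[< exists a s : R, mult_set S s /\ x = a%:F / s%:F >].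

Lemma loc_predP x :
  reflect (exists a s : R, mult_set S s /\ x = a%:F / s%:F) (x \in loc_pred).
Proof. exact: asboolP. Qed.

Lemma mult_tofrac_neq0 s : mult_set S s -> s%:F != 0.
Proof.
move=> Ss; rewrite tofrac_eq0; apply/eqP => s0.
by apply: (@mult_set_neq0 _ S); rewrite -s0.
Qed.

Lemma loc_pred_subring : subring_closed loc_pred.
Proof.
split=> [|x y|x y].
- apply/loc_predP; exists 1, 1; split; first exact: mult_set1.
  by rewrite tofrac1 divr1.
- move=> /loc_predP[a [s [Ss ->]]] /loc_predP[b [t [St ->]]].
  apply/loc_predP; exists (a * t - b * s), (s * t); split.
    exact: mult_setM.
  have s0 := mult_tofrac_neq0 Ss; have t0 := mult_tofrac_neq0 St.
  by rewrite -mulNr addf_div// tofracB !tofracM mulNr.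
- move=> /loc_predP[a [s [Ss ->]]] /loc_predP[b [t [St ->]]].
  apply/loc_predP; exists (a * b), (s * t); split; first exact: mult_setM.
  by rewrite !tofracM mulf_div.
Qed.

HB.instance Definition _ :=
  GRing.isSubringClosed.Build {fraction R} loc_pred loc_pred_subring.

Record localization := Localization {
  loc_val : {fraction R};
  loc_valP : loc_val \in loc_pred }.

HB.instance Definition _ := [isSub of localization for loc_val].
HB.instance Definition _ := [Choice of localization by <:].
HB.instance Definition _ := [SubChoice_isSubComNzRing of localization by <:].

Definition loc_unit : {pred localization} :=
  fun x => (val x != 0) && ((val x)^-1 \in loc_pred).

Definition loc_inv (x : localization) : localization :=
  if x \in loc_unit then insubd x (val x)^-1 else x.

Lemma loc_mulVx : {in loc_unit, left_inverse 1 loc_inv *%R}.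
Proof.
move=> x ux; apply: val_inj; rewrite /loc_inv ux rmorphM rmorph1 /=.
by case/andP: ux => x0 xV; rewrite val_insubd xV mulVf.
Qed.

Lemma loc_unitPl (x y : localization) : y * x = 1 -> loc_unit x.
Proof.
move=> /(congr1 val); rewrite rmorphM rmorph1 /= => yx1.
have x0 : val x != 0.
  by apply/eqP => x0; move/eqP: yx1; rewrite x0 mulr0 eq_sym oner_eq0.
rewrite /loc_unit x0 /=.
suff -> : (val x)^-1 = val y by exact: valP.
by apply: (mulIf x0); rewrite mulVf.
Qed.

Lemma loc_invr_out : {in [predC loc_unit], loc_inv =1 id}.
Proof. by move=> x /negbTE xN; rewrite /loc_inv xN. Qed.

HB.instance Definition _ := GRing.ComNzRing_hasMulInverse.Build localization
  loc_mulVx loc_unitPl loc_invr_out.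

Lemma loc_integral (x y : localization) : x * y = 0 -> (x == 0) || (y == 0).
Proof.
move=> /(congr1 val)/eqP; rewrite rmorphM rmorph0 /= mulf_eq0.
by rewrite -!(inj_eq val_inj) rmorph0.
Qed.

HB.instance Definition _ :=
  GRing.ComUnitRing_isIntegral.Build localization loc_integral.

Lemma tofrac_loc_pred a : a%:F \in loc_pred.
Proof.
apply/loc_predP; exists a, 1; split; first exact: mult_set1.
by rewrite tofrac1 divr1.
Qed.

Definition loc_map (a : R) : localization := Localization (tofrac_loc_pred a).

Lemma loc_map_zmod_morphism : zmod_morphism loc_map.
Proof. by move=> a b; apply: val_inj; rewrite rmorphB /= tofracB. Qed.

Lemma loc_map_monoid_morphism : monoid_morphism loc_map.
Proof.
split=> [|a b]; apply: val_inj; first by rewrite rmorph1 /= tofrac1.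
by rewrite rmorphM /= tofracM.
Qed.

HB.instance Definition _ := GRing.isZmodMorphism.Build R localization loc_map
  loc_map_zmod_morphism.
HB.instance Definition _ := GRing.isMonoidMorphism.Build R localization loc_map
  loc_map_monoid_morphism.

Lemma loc_map_inj : injective loc_map.
Proof. by move=> a b /(congr1 val)/eqP /=; rewrite tofrac_eq => /eqP. Qed.

End Localization.

(* A ring extension is given by its (injective) inclusion morphism, A being
   identified with its image in B. *)
Definition inert (A B : idomainType) (f : {rmorphism A -> B}) : Prop :=
  forall x y : B, x != 0 -> y != 0 -> range f (x * y) ->
    exists u : B, [/\ u \is a GRing.unit, range f (u * x)
                    & range f (u^-1 * y)].

Section WeakACCP.
Variable R : idomainType.

Definition irreducible_elt (x : R) : Prop :=
  [/\ x != 0, x \isn't a GRing.unit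
    & forall a b : R, x = a * b -> a \is a GRing.unit \/ b \is a GRing.unit].

Definition atomic : Prop :=
  forall x : R, x != 0 -> x \isn't a GRing.unit ->
    exists s : seq R, (forall a, a \in s -> irreducible_elt a) /\
      x = \prod_(a <- s) a.

Definition principal_ideal (a : R) : set R := range (fun r => r * a).

Definition satisfies_ACCP (x : R) : Prop :=
  forall I : nat -> set R,
    (forall n, exists a, I n = principal_ideal a) ->
    I 0%N = principal_ideal x ->
    (forall n, I n `<=` I n.+1) ->
    exists N, forall n, (N <= n)%N -> I n = I N.

Definition divides (d w : R) : Prop := exists q : R, w = q * d.

(* A common divisor d of W is nonzero, since W contains a nonzero element;
   hence the q below is the well-defined quotient w / d. *)
Definition weak_ACCP : Prop :=
  atomic /\
  forall W : set R, finite_set W -> W !=set0 -> ~ W 0 ->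
    exists d : R, (forall w, W w -> divides d w) /\
      exists w q : R, [/\ W w, w = q * d & satisfies_ACCP q].

End WeakACCP.

(* Main.v *)
Require Import Defs.
From HB Require Import structures.
From mathcomp Require Import all_boot all_order all_algebra.
From mathcomp Require Import boolp classical_sets cardinality.

(** Write [f] for the inclusion of [R] in its localization.  Two facts about
    [f] are enough: it is inert, and every element of the localization is a
    unit times some [f a], because the elements of [S] become invertible.  So
    the argument is carried out for any injective inert [f : A -> B] with the
    second property ([generates_up_to_units]).

    Inertness lifts factorizations: if [f a = x * y], then [a = b * c] in [A]
    with [x] and [y] associates of [f b] and [f c] ([inert_factor]).

    Atomicity: by this lifting, an irreducible of [A] becomes an irreducible or
    a unit of [B].  A nonzero nonunit of [B] is a unit times some [f a], and an
    atomic factorization of [a] gives one in [B] once the factors that became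
    units are absorbed into one that did not ([inert_atomic]).

    Common divisors: replace every element of a finite set [W] by an associate
    [f a] and take a common divisor [d] in [A] of the elements [a]; then [f d]
    divides every element of [W], with the same quotients up to units.  It
    remains to see that the ACCP passes from [q] to [f q] ([inert_ACCP]).  A
    chain of principal ideals of [B] starting at [f q] is a sequence of
    successive divisors, and lifting these factorizations one after the other
    gives a chain of principal ideals of [A] starting at [q], which generates
    the given chain; so the latter stabilizes with the former. *)

Import GRing.Theory.
Local Open Scope classical_set_scope.
Local Open Scope ring_scope.

Lemma divides_trans (R : idomainType) (a b c : R) :
  divides a b -> divides b c -> divides a c.
Proof. by move=> [p ->] [q ->]; exists (q * p); rewrite mulrA. Qed.

Lemma principal_idealP (R : idomainType) (a x : R) :
  principal_ideal a x <-> divides a x.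
Proof. by split=> [[r _ <-]|[r ->]]; exists r. Qed.

Lemma principal_ideal_sub (R : idomainType) (a b : R) :
  (principal_ideal a `<=` principal_ideal b) <-> divides b a.
Proof.
split=> [sub|ba x /principal_idealP ax].
  by apply/principal_idealP/sub; exists 1; rewrite ?mul1r.
exact/principal_idealP/(divides_trans _ _ _ _ ba).
Qed.

Lemma principal_ideal_unitl (R : idomainType) (u a : R) :
  u \is a GRing.unit -> principal_ideal (u * a) = principal_ideal a.
Proof.
move=> uU; apply/seteqP; split; apply/principal_ideal_sub; first by exists u.
by exists u^-1; rewrite mulKr.
Qed.

Lemma satisfies_ACCP_unitl (R : idomainType) (u a : R) :
  u \is a GRing.unit -> satisfies_ACCP a -> satisfies_ACCP (u * a).
Proof.
by move=> uU accp I Ip I0; apply: accp; rewrite // I0 principal_ideal_unitl.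
Qed.

Lemma irreducible_elt_unitl (R : idomainType) (u a : R) :
  u \is a GRing.unit -> irreducible_elt a -> irreducible_elt (u * a).
Proof.
move=> uU [a0 aN irr]; split.
- by apply: mulf_neq0 => //; apply: contraTneq uU => ->; rewrite unitr0.
- by rewrite unitrMr.
- move=> b c ubc.
  have := irr (u^-1 * b) c; rewrite -mulrA -ubc mulKr// => /(_ erefl).
  by rewrite unitrMr ?unitrV.
Qed.

Lemma prod_irreducible_or_unit (R : idomainType) (s : seq R) :
  (forall a, a \in s -> irreducible_elt a \/ a \is a GRing.unit) ->
  exists u t, [/\ u \is a GRing.unit, forall a, a \in t -> irreducible_elt a
                & \prod_(a <- s) a = u * \prod_(a <- t) a].
Proof.
elim: s => [_|a s IHs ias].
  by exists 1, [::]; split; rewrite ?unitr1 ?big_nil ?mulr1.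
have [|u [t [uU tirr st]]] := IHs.
  by move=> b bs; apply: ias; rewrite inE bs orbT.
rewrite big_cons st; have [airr|aU] := ias a (mem_head _ _).
  exists u, (a :: t); split=> // [b|]; last by rewrite big_cons mulrCA.
  by rewrite inE => /predU1P[->|/tirr].
by exists (a * u), t; split; rewrite ?unitrM ?aU ?mulrA.
Qed.

Definition generates_up_to_units {A B : idomainType} (f : A -> B) : Prop :=
  forall x : B, exists a u, u \is a GRing.unit /\ x = u * f a.

(** The units that inertness introduces in the two factors cancel, so by
    injectivity the factorization of [f a] comes from one of [a] itself. *)
Lemma inert_factor {A B : idomainType} (f : {rmorphism A -> B}) :
  injective f -> inert f -> forall (a : A) (x y : B), a != 0 -> f a = x * y ->
  exists b c u, [/\ u \is a GRing.unit, a = b * c, x = u * f b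
                  & y = u^-1 * f c].
Proof.
move=> finj finert a x y a0 fa.
have : x * y != 0 by rewrite -fa -(rmorph0 f) (inj_eq finj).
rewrite mulf_eq0 negb_or => /andP[x0 y0].
have [|u [uU [b _ fb] [c _ fc]]] := finert x y x0 y0; first by exists a.
exists b, c, u^-1; split; rewrite ?unitrV// ?fb ?fc ?invrK ?mulKr ?mulVKr//.
by apply: finj; rewrite rmorphM fb fc fa mulrACA mulrV// mul1r.
Qed.

Lemma inert_irreducible {A B : idomainType} (f : {rmorphism A -> B}) :
  injective f -> inert f ->
  forall a, irreducible_elt a -> irreducible_elt (f a) \/ f a \is a GRing.unit.
Proof.
move=> finj finert a [a0 _ irr].
have [|faN] := boolP (f a \is a GRing.unit); [by right | left].
split=> // [|x y fa]; first by rewrite -(rmorph0 f) (inj_eq finj).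
have [b [c [u [uU abc -> ->]]]] := inert_factor _ finj finert _ _ _ a0 fa.
by rewrite !unitrMr ?unitrV//; have [bU|cU] := irr _ _ abc;
  [left | right]; apply: rmorph_unit.
Qed.

Lemma inert_atomic {A B : idomainType} (f : {rmorphism A -> B}) :
  injective f -> inert f -> generates_up_to_units f -> atomic A -> atomic B.
Proof.
move=> finj finert fgen Aatomic x; have [a [u [uU ->]]] := fgen x.
rewrite mulf_eq0 negb_or unitrMr// => /andP[_ fa0] faN.
have a0 : a != 0 by apply: contraNneq fa0 => ->; rewrite rmorph0.
have [|s [sirr sE]] := Aatomic _ a0.
  by apply: contraNN faN => /(rmorph_unit f).
have [|v [t [vU tirr fsE]]] := prod_irreducible_or_unit _ (map f s).
  by move=> _ /mapP[b /sirr birr ->]; apply: inert_irreducible.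
have {sE fsE}faE : f a = v * \prod_(b <- t) b.
  by rewrite sE rmorph_prod -fsE big_map.
(* An empty t would make f a a unit; otherwise its head absorbs the units. *)
case: t tirr faE => [_ faE|b t tirr ->].
  by rewrite faE big_nil mulr1 vU in faN.
exists (u * v * b :: t); split; last by rewrite !big_cons !mulrA.
move=> c; rewrite inE => /predU1P[->|ct]; last first.
  by apply: tirr; rewrite inE ct orbT.
by apply: irreducible_elt_unitl (tirr _ (mem_head _ _)); rewrite unitrM uU.
Qed.

(** The generators of the ideals in a chain of [B] are only defined up to
    units; those in the image of [f] that inertness provides, each dividing the
    preceding one already in [A], are selected by recursion. *)
Lemma inert_ACCP {A B : idomainType} (f : {rmorphism A -> B}) :
  injective f -> inert f ->
  forall q, q != 0 -> satisfies_ACCP q -> satisfies_ACCP (f q).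
Proof.
move=> finj finert q q0 accp I Iprin I0 Iincr.
have lift n r : exists r', r != 0 -> I n = principal_ideal (f r) ->
    [/\ r' != 0, I n.+1 = principal_ideal (f r') & divides r' r].
  (* The value 0 is a default, taken when r does not generate the n-th ideal. *)
  have [r0|] := pselect (r != 0 /\ I n = principal_ideal (f r)); last first.
    by move=> nr; exists 0 => r0 In; case: nr.
  case: r0 => r0 In; have [x Ix] := Iprin n.+1.
  have : divides x (f r) by apply/principal_ideal_sub; rewrite -Ix -In.
  case=> y; rewrite mulrC => fr.
  have [b [c [u [uU rbc xu _]]]] := inert_factor _ finj finert _ _ _ r0 fr.
  exists b => _ _; split; last by exists c; rewrite mulrC.
    by apply: contraNneq r0 => b0; rewrite rbc b0 mul0r.
  by rewrite Ix xu principal_ideal_unitl.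
have [g gP] := choice (fun nr : nat * A => lift nr.1 nr.2).
pose r := fix r n := if n is m.+1 then g (m, r m) else q.
have rP n : r n != 0 /\ I n = principal_ideal (f (r n)).
  by elim: n => [//|n [rn0 In]]; have [] := gP (n, r n) rn0 In.
have [|//|n|N stab] := accp (fun n => principal_ideal (r n)).
- by move=> n; exists (r n).
- by have [rn0 In] := rP n; apply/principal_ideal_sub;
    have [] := gP (n, r n) rn0 In.
have f_sub a b : principal_ideal a `<=` principal_ideal b ->
    principal_ideal (f a) `<=` principal_ideal (f b).
  move/principal_ideal_sub=> [c ->]; apply/principal_ideal_sub.
  by exists (f c); rewrite rmorphM.
exists N => n Nn; rewrite (rP n).2 (rP N).2.
by apply/seteqP; split; apply: f_sub; rewrite stab.
Qed.

Lemma inert_weak_ACCP {A B : idomainType} (f : {rmorphism A -> B}) :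
  injective f -> inert f -> generates_up_to_units f ->
  weak_ACCP A -> weak_ACCP B.
Proof.
move=> finj finert fgen [Aatomic Aweak]; split.
  exact: inert_atomic fgen _.
move=> W Wfin [w0 Ww0] WN0.
have [num numP] := choice fgen.
have num_neq0 w : W w -> num w != 0.
  move=> Ww; apply/eqP => nw0; apply: WN0; have [u [_ wE]] := numP w.
  by move: Ww; rewrite wE nw0 rmorph0 mulr0.
have [| |[w /num_neq0/eqP]//|d [dW [_ [q [[w Ww <-] wq qaccp]]]]] :=
  Aweak (num @` W).
- exact: finite_image.
- by exists (num w0), w0.
exists (f d); split=> [x Wx|].
  have [u [_ ->]] := numP x; have [p ->] := dW (num x) (imageP _ Wx).
  by exists (u * f p); rewrite rmorphM mulrA.
have [u [uU wE]] := numP w.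
exists w, (u * f q); split=> //; first by rewrite {1}wE wq rmorphM mulrA.
apply: satisfies_ACCP_unitl => //; apply: inert_ACCP => //.
by apply: contraNneq (num_neq0 w Ww) => q0; rewrite wq q0 mul0r.
Qed.

Lemma loc_map_unit (R : idomainType) (S : multSubset R) (s : R) :
  mult_set S s -> loc_map S s \is a GRing.unit.
Proof.
move=> Ss; apply/andP; split; first exact: (mult_tofrac_neq0 Ss).
by apply/loc_predP; exists 1, s; rewrite tofrac1 div1r.
Qed.

Lemma loc_map_generates (R : idomainType) (S : multSubset R) :
  generates_up_to_units (@loc_map R S).
Proof.
move=> x; have /loc_predP[a [s [Ss xE]]] := valP x.
have sU := loc_map_unit _ _ _ Ss.
exists a, (loc_map S s)^-1; split; first by rewrite unitrV.
apply: (mulrI sU); rewrite mulVKr//; apply: val_inj.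
by rewrite rmorphM /= xE mulrC divfK// (mult_tofrac_neq0 Ss).
Qed.

Theorem proposition4p5 (R : idomainType) (S : multSubset R)
  (inertRS : inert (@loc_map R S)) (wR : weak_ACCP R) :
  weak_ACCP (localization S).
Proof.
exact: (inert_weak_ACCP _ (@loc_map_inj _ _) inertRS (loc_map_generates _ S)).
Qed.
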